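(* Let $S_{\lambda}\in\mathcal{B}(\ell^2(V))$ be a norm attaining quasi-$\ast$-paranormal weighted shift on $\ell^2(V)$ with weights $(\lambda_v)_{v\in V^0}$. Then there exists a $v \in V$ such that $\|S_{\lambda}^3e_v\| = \|S_{\lambda}\|^3$.
   Context: $G=(V,E)$ is a directed graph in which every vertex $v$ has at most one parent: $(u,v)\in E\subset V\times V$ means $u=par(v)$ is the parent of $v$, and $v$ is a child of $u$. A vertex with no parent is a root, and $V^0$ is $V$ minus the set of roots. $\ell^2(V)$ is the Hilbert space of square summable complex functions on $V$ with orthonormal basis $\{e_u\}_{u\in V}$, $e_u(v)=1$ if $v=u$ and $0$ otherwise. For complex weights $(\lambda_v)_{v\in V^0}$, the weighted shift $S_\lambda$ is given by $(S_\lambda f)(v)=\lambda_v f(par(v))$ if $v$ is not a root and $(S_\lambda f)(v)=0$ if $v$ is a root. $\mathcal{B}(\mathcal{H})$ denotes the bounded linear operators on a Hilbert space $\mathcal{H}$. An operator $T\in\mathcal{B}(\mathcal{H})$ is quasi-$\ast$-paranormal if $\|T^*Tx\|^2\le\|T^3x\|\,\|Tx\|$ for all $x\in\mathcal{H}$, and norm attaining if there is a non-zero $x\in\mathcal{H}$ with $\|Tx\|=\|T\|\,\|x\|$. *)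

(* Defs.v *)
From HB Require Import structures.
From mathcomp Require Import all_boot all_order all_algebra.
From mathcomp Require Import mathcomp_extra boolp classical_sets functions.
From mathcomp Require Import cardinality fsbigop reals ereal numfun esum.
From mathcomp Require Import complex ring lra.

Set Implicit Arguments.
Unset Strict Implicit.
Unset Printing Implicit Defensive.

Import Order.TTheory GRing.Theory Num.Theory.
Local Open Scope classical_set_scope.
Local Open Scope ring_scope.

Section summation.
Context {R : realType} {V : choiceType}.
Implicit Types a b : V -> R.

Definition rsummable a := summable [set: V] (EFin \o a).

(* The unconditional sum of [a], meaningful when [rsummable a]; the index set
   may be uncountable. *)
Definition rsum a : R :=
  fine (\esum_(v in [set: V]) (EFin \o a)^\+ v -
        \esum_(v in [set: V]) (EFin \o a)^\- v)%E.

Definition csum (a : V -> R[i]) : R[i] :=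
  Complex (rsum (fun v => complex.Re (a v))) (rsum (fun v => complex.Im (a v))).

Lemma le_rsummable a b :
  (forall v, `|a v| <= `|b v|) -> rsummable b -> rsummable a.
Proof.
move=> ab; apply: le_lt_trans; apply: le_esum => v _ /=.
by rewrite lee_fin.
Qed.

Lemma rsummableD a b : rsummable a -> rsummable b -> rsummable (a \+ b).
Proof. exact: summableD. Qed.

Lemma rsummableN a : rsummable a -> rsummable (\- a).
Proof. by move=> sa; apply: le_rsummable sa => v /=; rewrite normrN. Qed.

Lemma esum_scale (c : R) a : 0 <= c -> (forall v, 0 <= a v) ->
  (\esum_(v in [set: V]) (c * a v)%:E =
   c%:E * \esum_(v in [set: V]) (a v)%:E)%E.
Proof.
move=> c0 a0; rewrite /esum -ereal_supZl//; last first.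
  by apply/set0P; exists (\sum_(x \in set0) (a x)%:E)%E; exists set0.
congr ereal_sup; rewrite image_comp; apply: eq_imagel => A [Afin _] /=.
rewrite ge0_mule_fsumr; last by move=> v; rewrite lee_fin.
by apply: eq_fsbigr => v _; rewrite EFinM.
Qed.

Lemma rsummableZ (c : R) a : rsummable a -> rsummable (fun v => c * a v).
Proof.
rewrite /rsummable /summable => sa.
under eq_esum do rewrite /= normrM.
rewrite esum_scale//; case: (esum _ _) sa (esum_ge0 (S := [set: V])
  (fun v _ => abse_ge0 ((EFin \o a) v))) => [r _ _|//|//].
by rewrite -EFinM ltry.
Qed.

Lemma rsum_diff a p q : (forall v, a v = p v - q v) ->
  (forall v, 0 <= p v) -> (forall v, 0 <= q v) ->
  rsummable p -> rsummable q ->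
  rsum a = fine (\esum_(v in [set: V]) (p v)%:E)%E -
           fine (\esum_(v in [set: V]) (q v)%:E)%E.
Proof.
move=> apq p0 q0 sp sq; rewrite /rsum.
have -> : EFin \o a = ((EFin \o p) \- (EFin \o q))%E.
  by apply/funext => v /=; rewrite apq EFinB.
rewrite esumB//; last 2 first.
- by move=> v _; rewrite lee_fin.
- by move=> v _; rewrite lee_fin.
have fin f : (forall v, 0 <= f v) -> rsummable f ->
    (\esum_(v in [set: V]) (f v)%:E)%E \is a fin_num.
  move=> f0; rewrite /rsummable summableE.
  by under eq_esum do rewrite /= ger0_norm//.
by rewrite fineB//; exact: fin.
Qed.

Let ps a v := Num.max (a v) 0.
Let ng a v := Num.max (- a v) 0.

Let ps_ge0 a v : 0 <= ps a v. Proof. by rewrite /ps le_max lexx orbT. Qed.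
Let ng_ge0 a v : 0 <= ng a v. Proof. by rewrite /ng le_max lexx orbT. Qed.

Let psng a v : a v = ps a v - ng a v.
Proof.
rewrite /ps /ng; have [a0|a0] := leP 0 (a v).
  by rewrite max_r ?subr0// oppr_le0.
by rewrite max_l ?opprK ?add0r// oppr_ge0 ltW.
Qed.

Let sps a : rsummable a -> rsummable (ps a).
Proof.
apply: le_rsummable => v; rewrite ger0_norm//.
by rewrite /ps ge_max ler_norm/=.
Qed.

Let sng a : rsummable a -> rsummable (ng a).
Proof.
apply: le_rsummable => v; rewrite ger0_norm//.
by rewrite /ng ge_max normr_ge0 andbT -normrN ler_norm.
Qed.

Let fsum_fin a : (forall v, 0 <= a v) -> rsummable a ->
  (\esum_(v in [set: V]) (a v)%:E)%E \is a fin_num.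
Proof.
move=> f0; rewrite /rsummable summableE.
by under eq_esum do rewrite /= ger0_norm//.
Qed.

Lemma rsumD a b : rsummable a -> rsummable b ->
  rsum (fun v => a v + b v) = rsum a + rsum b.
Proof.
move=> sa sb.
rewrite (rsum_diff (p := fun v => ps a v + ps b v)
                   (q := fun v => ng a v + ng b v)); first last.
- by apply: rsummableD; exact: sng.
- by apply: rsummableD; exact: sps.
- by move=> v; rewrite addr_ge0.
- by move=> v; rewrite addr_ge0.
- by move=> v; rewrite (psng a v) (psng b v) /= opprD addrACA.
rewrite (rsum_diff (psng a))//; [|exact: sps|exact: sng].
rewrite (rsum_diff (psng b))//; [|exact: sps|exact: sng].
under eq_esum do rewrite EFinD.
rewrite esumD//; [|by move=> *; rewrite lee_fin..].
under [X in _ - fine X]eq_esum do rewrite EFinD.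
rewrite esumD//; [|by move=> *; rewrite lee_fin..].
rewrite !fineD; first by rewrite opprD addrACA.
- exact: fsum_fin (ng_ge0 a) (sng sa).
- exact: fsum_fin (ng_ge0 b) (sng sb).
- exact: fsum_fin (ps_ge0 a) (sps sa).
- exact: fsum_fin (ps_ge0 b) (sps sb).
Qed.

Lemma rsumN a : rsummable a -> rsum (fun v => - a v) = - rsum a.
Proof.
move=> sa; rewrite (rsum_diff (psng a))//; [|exact: sps|exact: sng].
rewrite (rsum_diff (p := ng a) (q := ps a))//; [|by move=> v; rewrite [a v]psng opprB|exact: sng|exact: sps].
by rewrite opprB.
Qed.

Lemma rsumZ (c : R) a : rsummable a -> rsum (fun v => c * a v) = c * rsum a.
Proof.
move=> sa; wlog c0 : c / 0 <= c => [h|].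
  have [|c0] := leP 0 c; first exact: h.
  rewrite -[c]opprK mulNr -h ?oppr_ge0 ?ltW// -rsumN; last exact: rsummableZ.
  by congr rsum; apply/funext => v; rewrite mulNr.
rewrite (rsum_diff (p := fun v => c * ps a v) (q := fun v => c * ng a v)); first last.
- by apply: rsummableZ; exact: sng.
- by apply: rsummableZ; exact: sps.
- by move=> v; rewrite mulr_ge0.
- by move=> v; rewrite mulr_ge0.
- by move=> v; rewrite (psng a v) mulrBr.
rewrite (rsum_diff (psng a))//; [|exact: sps|exact: sng].
rewrite !esum_scale// !fineM//; first by rewrite mulrBr.
- exact: fsum_fin (ng_ge0 a) (sng sa).
- exact: fsum_fin (ps_ge0 a) (sps sa).
Qed.

Lemma rsum_ge0 a : (forall v, 0 <= a v) -> rsummable a ->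
  rsum a = fine (\esum_(v in [set: V]) (a v)%:E)%E.
Proof.
move=> a0 sa; rewrite (rsum_diff (p := a) (q := fun=> 0))//.
- by rewrite [X in _ - fine X]esum1//= subr0.
- by move=> v; rewrite subr0.
- by rewrite /rsummable /summable esum1//= => v _; rewrite normr0.
Qed.

End summation.

Section ell2.
Context {R : realType} {V : choiceType}.
Implicit Types f g : V -> R[i].

Definition square_summable : {pred V -> R[i]} :=
  [pred f | `[< rsummable (fun v => Normc.normc (f v) ^+ 2) >]].

Lemma sqr_normc_ReIm (z : R[i]) :
  Normc.normc z ^+ 2 = complex.Re z ^+ 2 + complex.Im z ^+ 2.
Proof. by case: z => a b /=; rewrite sqr_sqrtr// addr_ge0// sqr_ge0. Qed.

Lemma sqr_normcD_le (x y : R[i]) : Normc.normc (x + y) ^+ 2 <=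
  2 * Normc.normc x ^+ 2 + 2 * Normc.normc y ^+ 2.
Proof.
rewrite !sqr_normc_ReIm; case: x y => [a b] [c d] /=.
have := sqr_ge0 (a - c); have := sqr_ge0 (b - d); nra.
Qed.

Lemma square_summable_submod_closed : submod_closed square_summable.
Proof.
split.
  apply/asboolP; rewrite /rsummable /summable esum1// => v _ /=.
  by rewrite expr0n/= addr0 sqrtr0 expr0n normr0.
move=> c f g /asboolP sf /asboolP sg; apply/asboolP.
have := rsummableD (rsummableZ (2 * Normc.normc c ^+ 2) sf) (rsummableZ 2 sg).
apply: le_rsummable => v /=.
rewrite ger0_norm ?sqr_ge0// (le_trans _ (ler_norm _))//.
by rewrite -mulrA -exprMn -Normc.normcM; exact: sqr_normcD_le.
Qed.

HB.instance Definition _ := GRing.isSubmodClosed.Build _ _ square_summable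
  square_summable_submod_closed.

End ell2.

Record ell2 (R : realType) (V : choiceType) := Ell2 {
  ell2_fun :> V -> R[i] ;
  ell2_funP : ell2_fun \in square_summable }.
Arguments ell2_funP {R V}.

HB.instance Definition _ (R : realType) (V : choiceType) :=
  [isSub of ell2 R V for @ell2_fun R V].
HB.instance Definition _ (R : realType) (V : choiceType) :=
  [Choice of ell2 R V by <:].
HB.instance Definition _ (R : realType) (V : choiceType) :=
  [SubChoice_isSubLmodule of ell2 R V by <:].

Section ell2_dot.
Context {R : realType} {V : choiceType}.
Implicit Types f g h : ell2 R V.

Lemma ell2D f g v : (f + g) v = f v + g v. Proof. by []. Qed.
Lemma ell2Z (c : R[i]) f v : (c *: f) v = c * f v. Proof. by []. Qed.

Definition ell2_dot f g : R[i] := csum (fun v => f v * conjc (g v)).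

Let ell2_summable f g :
  rsummable (fun v => complex.Re (f v * conjc (g v))) /\
  rsummable (fun v => complex.Im (f v * conjc (g v))).
Proof.
have [/asboolP sf /asboolP sg] := (ell2_funP f, ell2_funP g).
split; apply: le_rsummable (rsummableD sf sg) => v /=;
  rewrite !sqr_normc_ReIm; case: (f v) (g v) => [a b] [c d] /=;
  rewrite [leRHS]ger0_norm ?addr_ge0 ?sqr_ge0// ler_norml;
  have := sqr_ge0 (a - c); have := sqr_ge0 (b - d);
  have := sqr_ge0 (a + c); have := sqr_ge0 (b + d);
  have := sqr_ge0 (a - d); have := sqr_ge0 (b - c);
  have := sqr_ge0 (a + d); have := sqr_ge0 (b + c);
  move=> *; apply/andP; split; nra.
Qed.

Let ell2_dotC f g : ell2_dot f g = (-1) ^+ false * (ell2_dot g f)^*.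
Proof.
rewrite expr0 mul1r /ell2_dot /csum /=.
have [_ si] := ell2_summable g f.
rewrite -[RHS]/(conjc _) /= -rsumN//; congr Complex; congr rsum;
  apply/funext => v; case: (f v) (g v) => [a b] [c d] /=; lra.
Qed.

Let ell2_dotDl f g h : ell2_dot (f + g) h = ell2_dot f h + ell2_dot g h.
Proof.
have [fr fi] := ell2_summable f h; have [gr gi] := ell2_summable g h.
rewrite /ell2_dot /csum -[RHS]/(Complex _ _) -!rsumD//.
by congr Complex; congr rsum; apply/funext => v; rewrite ell2D;
  case: (f v) (g v) (h v) => [a b] [c d] [k l] /=; lra.
Qed.

Let ell2_dotZl c f g : ell2_dot (c *: f) g = c * ell2_dot f g.
Proof.
have [sr si] := ell2_summable f g; case: c => c d.
rewrite /ell2_dot /csum -[RHS]/(Complex _ _) -!rsumZ//.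
have sZ x a : rsummable a -> rsummable (fun v : V => (x : R) * a v).
  exact: rsummableZ.
rewrite -(rsumN (sZ d _ si)) -(rsumD (sZ c _ sr) (rsummableN (sZ d _ si))).
rewrite -(rsumD (sZ c _ si) (sZ d _ sr)).
by congr Complex; congr rsum; apply/funext => v; rewrite ell2Z/=;
  case: (f v) (g v) => [k l] [m n] /=; ring.
Qed.

Let ell2_dot_bilinear :
  bilinear_for *%R (Num.conj \; *%R) ell2_dot.
Proof.
split=> [h c f g|h c f g] /=.
  by rewrite ell2_dotDl ell2_dotZl.
rewrite ell2_dotC ell2_dotDl ell2_dotZl expr0 mul1r rmorphD rmorphM/=.
by rewrite (ell2_dotC h f) (ell2_dotC h g) !expr0 !mul1r.
Qed.

HB.instance Definition _ := bilinear_isBilinear.Build R[i] (ell2 R V)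
  (ell2 R V) R[i] *%R (Num.conj \; *%R) ell2_dot ell2_dot_bilinear.

HB.instance Definition _ := isHermitianSesquilinear.Build R[i] (ell2 R V)
  false Num.conj ell2_dot ell2_dotC.

Lemma ell2_dotE f : ell2_dot f f =
  Complex (fine (\esum_(v in [set: V]) (Normc.normc (f v) ^+ 2)%:E)%E) 0.
Proof.
have /asboolP sf := ell2_funP f.
rewrite -rsum_ge0//; last by move=> v; exact: sqr_ge0.
have r0 : @rsum R V (fun=> 0) = 0.
  rewrite rsum_ge0 ?esum1// /rsummable /summable esum1//= => v _.
  by rewrite normr0.
rewrite -[X in Complex _ X]r0; congr Complex; congr rsum; apply/funext => v.
  by rewrite sqr_normc_ReIm; case: (f v) => a b /=; ring.
by case: (f v) => a b /=; ring.
Qed.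

Let ell2_dot_gt0 f : f != 0 -> 0 < ell2_dot f f.
Proof.
have /asboolP sf := ell2_funP f.
move=> f0; rewrite ell2_dotE ltcE/= eqxx/=.
have [v fv0] : exists v, f v != 0.
  apply/not_existsP => h; move/negP: f0; apply; apply/eqP/val_inj/funext => v.
  by apply/eqP/negPn/negP; exact: h.
rewrite fine_gt0//; apply/andP; split; last first.
  by move: sf; congr (_ < _)%E; apply: eq_esum => w _ /=; rewrite ger0_norm ?sqr_ge0.
rewrite (esumID [set v]); last by move=> w _; rewrite lee_fin sqr_ge0.
rewrite setTI esum_set1 ?lee_fin ?sqr_ge0// (@lt_le_trans _ _ (Normc.normc (f v) ^+ 2)%:E)//; last first.
  rewrite leeDl//.
  by apply: esum_ge0 => w _; rewrite lee_fin sqr_ge0.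
rewrite lte_fin exprn_even_gt0//=; apply/eqP => /Normc.eq0_normc.
exact/eqP.
Qed.

HB.instance Definition _ := isDotProduct.Build R[i] (ell2 R V)
  ell2_dot ell2_dot_gt0.

End ell2_dot.

Section ell2_basis.
Context {R : realType} {V : choiceType}.

Definition ell2_delta (u : V) : V -> R[i] := fun v => (v == u)%:R.

Lemma ell2_delta_subproof u : ell2_delta u \in square_summable.
Proof.
apply/asboolP; rewrite /rsummable /summable (esumID [set u])//.
rewrite setTI esum_set1// [X in (_ + X)%E]esum1 ?adde0 ?ltry// => v [_ /= vu].
by rewrite /ell2_delta (negbTE (introN eqP vu)) Normc.normc0 expr0n normr0.
Qed.

Definition ell2_basis (u : V) : ell2 R V := Ell2 (ell2_delta_subproof u).
End ell2_basis.

Section operators.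
Context {R : realType} {H : lmodType R[i]} (dot : {dot H for Num.conj}).
Implicit Type T : {linear H -> H}.

Definition hnorm (x : H) : R := Num.sqrt (complex.Re (dot x x)).

Definition bounded_op T := exists M : R, forall x, hnorm (T x) <= M * hnorm x.

Definition opnorm T : R := sup [set hnorm (T x) | x in [set x | hnorm x <= 1]].

(* [adjoint T y] is the vector z such that <T x, y> = <x, z> for all x: it is
   unique, and it exists for every y when T is bounded and H is complete. *)
Definition adjoint T (y : H) : H :=
  xget 0 [set z | forall x, dot (T x) y = dot x z].

Definition quasi_star_paranormal T := forall x,
  hnorm (adjoint T (T x)) ^+ 2 <= hnorm (T (T (T x))) * hnorm (T x).

Definition norm_attaining T :=
  exists2 x, x != 0 & hnorm (T x) = opnorm T * hnorm x.

End operators.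

Section directed_graph.
Context {R : realType} {V : choiceType}.
(* [E (u, v)] means that u is a parent of v. *)
Variable E : set (V * V).

Definition at_most_one_parent :=
  forall u u' v, E (u, v) -> E (u', v) -> u = u'.

Definition roots : set V := [set v | forall u, ~ E (u, v)].

Definition nonroots : set V := [set: V] `\` roots.

(* The value v at a root is a dummy. *)
Definition par (v : V) : V := xget v [set u | E (u, v)].

Definition wshift (lam : set_type nonroots -> R[i]) (f : V -> R[i]) : V -> R[i] :=
  fun v => if (insub v : option (set_type nonroots)) is Some w
           then lam w * f (par v) else 0.

End directed_graph.

(* Main.v *)
(* With [N = ||S||], the operator [S^* S] is diagonal: [S^* S e_u = ||S e_u||^2 e_u].
   If [||S x|| = N ||x||] and [x u != 0], split [x = y + x_u e_u] with [y]
   orthogonal to [e_u]; then [S y] is orthogonal to [S e_u], so by Pythagoras and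
   [||S y|| <= N ||y||] we get [||S e_u|| = N].  The quasi-*-paranormal inequality
   at [e_u] reads [N^4 <= ||S^3 e_u|| N]. *)
Require Import Defs.
From mathcomp Require Import all_boot all_order all_algebra.
From mathcomp Require Import boolp classical_sets functions reals complex.
From mathcomp Require Import constructive_ereal esum lra.
Import Order.TTheory GRing.Theory Num.Theory.
Local Open Scope classical_set_scope.
Local Open Scope ring_scope.

Section hnorm_theory.
Context {R : realType} {H : lmodType R[i]} (dot : {dot H for Num.conj}).
Implicit Types (x y : H) (T : {linear H -> H}).

Lemma hnorm_ge0 x : 0 <= hnorm dot x.
Proof. exact: sqrtr_ge0. Qed.

(** A complex number that is [0 <=] is real, so nothing is lost in the real part; identities for
    [dot] thus transfer to [hnorm]. *)
Lemma sqr_hnorm x : ((hnorm dot x ^+ 2)%:C)%C = dot x x.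
Proof.
have : 0 <= dot x x by exact: dnorm_ge0.
rewrite /hnorm; case: (dot x x) => a b; rewrite lecE/= => /andP[/eqP -> a0].
by rewrite sqr_sqrtr.
Qed.

Lemma hnorm_eq0 x : (hnorm dot x == 0) = (x == 0).
Proof.
rewrite -(dnorm_eq0 dot) -sqr_hnorm -[0 in RHS]/(0%:C)%C.
by rewrite (inj_eq (@complexI R)) sqrf_eq0.
Qed.

Lemma hnorm0 : hnorm dot 0 = 0.
Proof. by apply/eqP; rewrite hnorm_eq0. Qed.

Lemma sqr_hnormZ (c : R[i]) x :
  hnorm dot (c *: x) ^+ 2 = Normc.normc c ^+ 2 * hnorm dot x ^+ 2.
Proof.
apply: (@complexI R); rewrite sqr_hnorm dnormZ -sqr_hnorm !expr2.
by rewrite !rmorphM.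
Qed.

Lemma hnormZ_ge0 (c : R) x : 0 <= c ->
  hnorm dot ((c%:C)%C *: x) = c * hnorm dot x.
Proof.
move=> c0; apply/eqP; rewrite -(@eqrXn2 _ 2) ?mulr_ge0 ?hnorm_ge0//.
by rewrite sqr_hnormZ exprMn sqr_normc_ReIm /= expr0n addr0.
Qed.

Lemma sqr_hnormD x y : dot x y = 0 ->
  hnorm dot (x + y) ^+ 2 = hnorm dot x ^+ 2 + hnorm dot y ^+ 2.
Proof.
move=> xy; apply: (@complexI R).
by rewrite rmorphD/= !sqr_hnorm hnormDd.
Qed.

Lemma opnorm_ball T y : bounded_op dot T -> hnorm dot y <= 1 ->
  hnorm dot (T y) <= opnorm dot T.
Proof.
move=> [M TM] y1; have ubT :
    has_ubound [set hnorm dot (T x) | x in [set x | hnorm dot x <= 1]].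
  (* The sign of [M] is unknown; the last estimate needs a nonnegative constant. *)
  exists `|M| => _ [z /= z1 <-]; apply: (le_trans (TM z)).
  apply: (@le_trans _ _ (`|M| * hnorm dot z)).
    by rewrite ler_wpM2r ?hnorm_ge0// ler_norm.
  by rewrite ler_piMr.
by have /ubP := ub_le_sup ubT; apply; exists y.
Qed.

Lemma opnorm_le T x : bounded_op dot T ->
  hnorm dot (T x) <= opnorm dot T * hnorm dot x.
Proof.
move=> Tb; have [->|x0] := eqVneq x 0.
  by rewrite linear0 hnorm0 mulr0.
have nx0 : 0 < hnorm dot x by rewrite lt_def hnorm_ge0 hnorm_eq0 x0.
rewrite -ler_pdivrMr// mulrC -hnormZ_ge0 ?invr_ge0 ?hnorm_ge0// -linearZ.
apply: opnorm_ball => //.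
by rewrite hnormZ_ge0 ?invr_ge0 ?hnorm_ge0// mulVf ?hnorm_eq0.
Qed.

Lemma opnorm_ge0 T : bounded_op dot T -> 0 <= opnorm dot T.
Proof.
move=> Tb; apply: le_trans (opnorm_ball T 0 Tb _); last by rewrite hnorm0.
exact: hnorm_ge0.
Qed.

(** Two candidates [z] and [z'] have the same product with every vector, in particular with
    [z' - z], so [z' - z] has norm zero. *)
Lemma adjointE T y z : (forall x, dot (T x) y = dot x z) ->
  adjoint dot T y = z.
Proof.
move=> Tz; apply: xget_unique => //= z' Tz'; apply/eqP.
by rewrite -subr_eq0 -(dnorm_eq0 dot) linearBr/= -Tz -Tz' subrr.
Qed.

End hnorm_theory.

Section ell2_basis_theory.
Context {R : realType} {V : choiceType}.
Implicit Types (f : ell2 R V) (u : V).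

Local Notation dot := (@ell2_dot R V).
Local Notation e := (@ell2_basis R V).

Lemma hnorm_ell2_basis u : hnorm dot (e u) = 1.
Proof.
rewrite /hnorm -[X in complex.Re X]/(ell2_dot (e u) (e u)) ell2_dotE /= (esumID [set u])//; last first.
  by move=> v _; rewrite lee_fin sqr_ge0.
rewrite setTI esum_set1 ?lee_fin ?sqr_ge0// [X in (_ + X)%E]esum1.
  by rewrite adde0/= /ell2_delta eqxx Normc.normc1 expr1n sqrtr1.
move=> v [_ /= vu].
by rewrite /ell2_delta (negbTE (introN eqP vu)) Normc.normc0 expr0n.
Qed.

Lemma ell2_dot_basis f u : dot f (e u) = f u.
Proof.
(* The two sums agree term by term, so no infinite sum has to be evaluated. *)
have -> : dot f (e u) = dot (f u *: e u) (e u).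
  congr csum; apply/funext => v; rewrite ell2Z /= /ell2_delta.
  by have [->|_] := eqVneq v u; rewrite ?mulr1// !rmorph0 !mulr0.
by rewrite linearZl_LR/= -sqr_hnorm hnorm_ell2_basis expr1n mulr1.
Qed.

Context {E : set (V * V)} {lam : set_type (nonroots E) -> R[i]}.
Variable S : {linear ell2 R V -> ell2 R V}.
Hypothesis S_shift : forall f, S f = wshift lam f :> (V -> R[i]).

(** [S (e u)] vanishes off the children of [u], and on them [S f] is [f u] times [S (e u)]. *)
Lemma wshift_dot_basis f u :
  dot (S f) (S (e u)) = f u * ((hnorm dot (S (e u)) ^+ 2)%:C)%C.
Proof.
rewrite sqr_hnorm -[RHS](linearZl_LR dot).
congr csum; apply/funext => v; rewrite ell2Z !S_shift /wshift.
case: insub => [w|]; last by rewrite !rmorph0 !mulr0.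
rewrite /= /ell2_delta; have [->|_] := eqVneq (par E v) u.
  by rewrite mulr1 (mulrC (f u)).
by rewrite !(mulr0, rmorph0).
Qed.

Lemma adjoint_wshift_basis u :
  adjoint dot S (S (e u)) = ((hnorm dot (S (e u)) ^+ 2)%:C)%C *: e u.
Proof.
apply: adjointE => f /=; rewrite wshift_dot_basis linearZr_LR/= ell2_dot_basis.
(* The second slot of [dot] is conjugate linear, but the scalar is real. *)
by rewrite mulrC; congr (_ * _); exact/esym/conjc_real.
Qed.

Lemma norm_attaining_basis : bounded_op dot S -> norm_attaining dot S ->
  exists u, hnorm dot (S (e u)) = opnorm dot S.
Proof.
move=> Sb [x x0 Sx].
have [u xu0] : exists u, x u != 0.
  apply/not_existsP => h; move/negP: x0; apply; apply/eqP/val_inj/funext => v.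
  by apply/eqP/negPn/negP; exact: h.
exists u; apply/eqP; rewrite eq_le; apply/andP; split.
  by have := opnorm_le dot S (e u) Sb; rewrite hnorm_ell2_basis mulr1.
(* The reverse inequality is proved for squares, where Pythagoras applies. *)
rewrite -(@ler_pXn2r _ 2) ?nnegrE ?opnorm_ge0 ?hnorm_ge0//.
pose y := x - x u *: e u.
have xE : x = y + x u *: e u by rewrite subrK.
have yu : y u = 0 by rewrite /y -scaleNr ell2D ell2Z /= /ell2_delta eqxx mulr1 subrr.
have y_e : dot y (x u *: e u) = 0.
  by rewrite linearZr_LR/= ell2_dot_basis yu mulr0.
have Sy_Se : dot (S y) (S (x u *: e u)) = 0.
  by rewrite linearZ linearZr_LR/= wshift_dot_basis yu mul0r mulr0.
have xn := sqr_hnormD dot _ _ y_e; rewrite -xE sqr_hnormZ hnorm_ell2_basis in xn.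
have Sxn := sqr_hnormD dot _ _ Sy_Se.
rewrite -linearD -xE Sx linearZ sqr_hnormZ exprMn xn in Sxn.
have Sy : hnorm dot (S y) ^+ 2 <= opnorm dot S ^+ 2 * hnorm dot y ^+ 2.
  by rewrite -exprMn ler_pXn2r ?nnegrE ?mulr_ge0 ?opnorm_ge0 ?hnorm_ge0//
    opnorm_le.
have c0 : 0 < Normc.normc (x u) ^+ 2.
  by rewrite exprn_even_gt0//=; apply: contra_neq xu0 => /Normc.eq0_normc.
(* With [N] the norm of [S] and [c = |x u|^2]: [N^2 (|y|^2 + c) = |S y|^2 + c |S e_u|^2 <= N^2 |y|^2
   + c |S e_u|^2]; cancel [N^2 |y|^2]. *)
rewrite -(ler_pM2l c0); move: Sxn Sy; rewrite expr1n mulr1 mulrDr; lra.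
Qed.

End ell2_basis_theory.

Theorem corollary3p3 (R : realType) (V : choiceType) (E : set (V * V))
  (HE : at_most_one_parent E)
  (lam : set_type (nonroots E) -> R[i])
  (Slam : {linear ell2 R V -> ell2 R V})
  (S_shift : forall f : ell2 R V, Slam f = wshift lam f :> (V -> R[i]))
  (S_bounded : bounded_op ell2_dot Slam)
  (S_quasi : quasi_star_paranormal ell2_dot Slam)
  (S_attains : norm_attaining ell2_dot Slam) :
  exists v : V,
    hnorm ell2_dot (Slam (Slam (Slam (ell2_basis v)))) = opnorm ell2_dot Slam ^+ 3.
Proof.
have [u Su] := norm_attaining_basis Slam S_shift S_bounded S_attains.
exists u; set N := opnorm _ _ in Su *.
have N0 : 0 <= N by exact: opnorm_ge0.
have SN x : hnorm ell2_dot (Slam x) <= N * hnorm ell2_dot x.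
  exact: opnorm_le.
apply/eqP; rewrite eq_le; apply/andP; split.
  (* Upper bound: two applications of [SN] reduce it to [Su]. *)
  rewrite exprS expr2; apply: (le_trans (SN _)); rewrite ler_wpM2l//.
  by apply: (le_trans (SN _)); rewrite Su.
(* The lower bound comes from cancelling a factor [N], so [N = 0] is treated apart. *)
have [->|Nneq0] := eqVneq N 0; first by rewrite expr0n hnorm_ge0.
have Npos : 0 < N by rewrite lt_def Nneq0.
have := S_quasi (ell2_basis u).
(* The left side becomes [(N^2)^2], rewritten as [N^3 * N] to match the factor [N] on the right. *)
rewrite (adjoint_wshift_basis Slam S_shift) hnormZ_ge0 ?sqr_ge0//.
by rewrite hnorm_ell2_basis mulr1 Su -exprM (exprSr N 3) ler_pM2r.
Qed.
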